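(* For any $\tau_{\rm fin}>0$ there is a constant $d_*>0$, which depends on $\alpha$, $\beta$ and $\tau_{\rm fin}$, along with a constant $0<\varepsilon_*<1$, which depends only on $\alpha$ and $\beta$, such that $$\varepsilon\,(t^*_{k+1}-t^*_k)\ \ge\ 2d_*$$ holds for all $k\ge1$ with $0\le t^*_k\le\tau_{\rm fin}/\varepsilon^2$, provided that $\varepsilon\le\varepsilon_*$.
   Context: Set $\Phi'(u)=u-\operatorname{sgn}u$, where $\operatorname{sgn}u=-1$ for $u<0$ and $\operatorname{sgn}u=+1$ for $u\ge0$. Write $\nabla_+p_j=p_{j+1}-p_j$ and $\Delta p_j=p_{j+1}-2p_j+p_{j-1}$. For $k\in\mathbb{Z}$ let $$X_k=\Big\{u\in\ell^\infty(\mathbb{Z}):\ 0<\inf_{j<k}u_j\le\sup_{j<k}u_j<\infty,\ -2<\inf_{j\ge k}u_j\le\sup_{j\ge k}u_j<0\Big\}.$$ For initial data $u(0)\in X_1$ the single-interface solution is the (unique, globally existing) continuous $u:[0,\infty)\to\ell^\infty(\mathbb{Z})$ for which there is a sequence of phase transition times $(t^*_k)_{k\ge1}\subset(0,\infty]$ such that, with $t^*_0:=0$: (1) for all $k\ge1$, either $t^*_{k-1}=\infty$ or $t^*_{k-1}<t^*_k$; (2) $\dot u_j=\Delta\Phi'(u_j)$ for all $t\in[0,\infty)\setminus\{t^*_k:k\ge1\}$; (3) $u_k(t^*_k)=0$ and $\lim_{t\searrow t^*_k}\dot u_k(t)>0$ whenever $t^*_k<\infty$; (4) $u$ takes values in $X_k$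 on $(t^*_{k-1},t^*_k)$ whenever $t^*_{k-1}<\infty$. Standing assumption on initial data (macroscopic single-interface initial data). For each scaling parameter $\varepsilon>0$ initial data $u(0)\in X_1$ (depending on $\varepsilon$) are given such that $p(0)=\Phi'(u(0))$ satisfies $$|\Delta p_0(0)|\le\beta\varepsilon,\qquad \sup_{j\in\mathbb{Z}}|\nabla_+p_j(0)|\le\alpha\varepsilon,\qquad \sup_{j\ne0}|\Delta p_j(0)|\le\alpha\varepsilon^2,$$ with constants $\alpha,\beta$ independent of $\varepsilon$; $t^*_k$ are the phase transition times of the corresponding single-interface solution. *)

(* Defs.v *)
From HB Require Import structures.
From mathcomp Require Import all_boot all_order all_algebra.
From mathcomp Require Import all_classical all_reals all_analysis.

Set Implicit Arguments.
Unset Strict Implicit.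
Unset Printing Implicit Defensive.

Import Order.TTheory GRing.Theory Num.Theory.
Import numFieldNormedType.Exports.
Local Open Scope classical_set_scope.
Local Open Scope ring_scope.

(* Num.sg cannot be used here: it vanishes at 0. *)
Definition sgnr (R : realType) (x : R) : R := if x < 0 then -1 else 1.

Definition dPhi (R : realType) (x : R) : R := x - sgnr x.

Definition nablap (R : realType) (p : int -> R) (j : int) : R :=
  p (j + 1) - p j.

Definition lap (R : realType) (p : int -> R) (j : int) : R :=
  p (j + 1) - 2 * p j + p (j - 1).

Definition Xset (R : realType) (k : int) : set (int -> R) :=
  [set v : int -> R |
   let L := [set (v j)%:E | j in [set j : int | j < k]] in
   let U := [set (v j)%:E | j in [set j : int | k <= j]] in
   [/\ bounded_fun v,
       (0%R%:E < ereal_inf L <= ereal_sup L)%E,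
       (ereal_sup L < +oo)%E,
       ((- 2%R)%R%:E < ereal_inf U <= ereal_sup U)%E &
       (ereal_sup U < 0%R%:E)%E]].

(* Only the restriction of [u] to nonnegative times is constrained; at time 0,
   which is never a phase transition time, the time derivative is one-sided.
   Continuity into l^oo is continuity, on [0, +oo[, for the topology of uniform
   convergence, together with boundedness of every u t. *)
Record single_interface_solution (R : realType)
    (u : R -> int -> R) (T : nat -> \bar R) : Prop := SingleInterfaceSolution {
  sis_linfty : forall t : R, 0 <= t -> bounded_fun (u t);
  sis_continuous : {within `[0, +oo[, continuous (u : R -> {uniform int -> R})};
  sis_T0 : T 0%N = 0%:E;
  sis_T_gt0 : forall k : nat, (1 <= k)%N -> (0%:E < T k)%E;
  sis_T_increasing : forall k : nat, (1 <= k)%N ->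
    T k.-1 = +oo%E \/ (T k.-1 < T k)%E;
  sis_ode : forall (t : R) (j : int), 0 < t ->
    (forall k : nat, (1 <= k)%N -> T k <> t%:E) ->
    is_derive t 1 (fun s : R => u s j) (lap (@dPhi R \o u t) j);
  sis_ode0 : forall j : int,
    (t^-1 * (u t j - u 0 j)) @[t --> (0 : R)^'+] --> lap (@dPhi R \o u 0) j;
  sis_transition : forall (k : nat) (s : R), (1 <= k)%N -> T k = s%:E ->
    u s k%:Z = 0 /\
    exists2 l : R, 0 < l &
      derive1 (fun t : R => u t k%:Z) t @[t --> s^'+] --> l;
  sis_phases : forall k : nat, (1 <= k)%N -> (T k.-1 < +oo)%E ->
    forall t : R, (T k.-1 < t%:E < T k)%E -> Xset k%:Z (u t)
}.

Definition macroscopic_initial_data (R : realType) (alpha beta eps : R)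
    (u0 : int -> R) : Prop :=
  let p := @dPhi R \o u0 in
  [/\ Xset 1 u0,
      `|lap p 0| <= beta * eps,
      (ereal_sup [set `|nablap p j|%R%:E | j in [set: int]]
         <= (alpha * eps)%:E)%E &
      (ereal_sup [set `|lap p j|%R%:E | j in [set j : int | j != 0%R]]
         <= (alpha * eps ^+ 2)%:E)%E].

(* Main.v *)
Require Import Defs.
From HB Require Import structures.
From mathcomp Require Import all_boot all_order all_algebra ring lra zify.
From mathcomp Require Import all_classical all_reals all_analysis.
Import Order.TTheory GRing.Theory Num.Theory.
Import numFieldNormedType.Exports.
Local Open Scope classical_set_scope.
Local Open Scope ring_scope.

(* During phase k the deviation z = 1 - Phi'(u) solves the discrete heat
   equation and is nonnegative at the sites j >= k. Since linear functions are
   caloric, the comparison principle behind the interface propagates the initial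
   gradient bound in the form z_j >= - A (k - j)^+ with A = O(eps), from one phase
   to the next. A transition at site k adds 2 to z_k, so that afterwards z is at
   least twice the lattice heat kernel minus A times the caloric evolution of
   (k - j)^+. At site k and time s after the transition the former is of order
   s^(-1/2) and the latter of order A s^(1/2), hence z_k >= 0 as long as s is at
   most a small multiple of 1/A. As long as z_k >= 0, the site k + 1 satisfies
   z' >= -2 z, so z_(k+1) cannot reach 0, i.e. the next transition cannot occur. *)

(** * Comparison principle for the lattice heat equation *)

(** Difference quotients with negative increment are nonpositive, and the derivative is their limit.
    A minimum over past times suffices, so the lemma also applies at the last time of a segment. *)
Lemma is_derive_left_min_le0 (R : realType) (f : R -> R) (a t d : R) :
  a < t -> is_derive t 1 f d -> (forall s, a <= s <= t -> f t <= f s) -> d <= 0.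
Proof.
move=> at_ [df <-] ft; rewrite ['D_1 f t]cvg_at_leftE//.
apply: limr_le.
  rewrite -(cvg_at_leftE (fun h => h^-1 *: ((f \o shift t) _ - f t))) //.
  apply: cvg_trans df; apply: cvg_app.
  move=> A [e egt0 Ae]; exists e => // x xe xgt0; apply: Ae => //.
  exact/ltr0_neq0.
near=> h; apply: mulr_le0_ge0.
  by rewrite invr_le0; apply: ltW; near: h; exists 1 => /=.
rewrite subr_ge0 [_%:A]mulr1; apply: ft; near: h.
exists (t - a); first by rewrite /= subr_gt0.
move=> h /=; rewrite distrC subr0 => /ltr_normlP[h1 h2] h0.
by apply/andP; split; lra.
Unshelve. all: by end_near. Qed.

Lemma segment_uniform_min (R : realType) (f : R -> int -> R) (a b : R)
    (K : nat) :
  a <= b -> (forall j, {within `[a, b], continuous (fun t => f t j)}) ->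
  exists t0 j0, [/\ a <= t0 <= b, `|j0| <= K%:Z &
    forall t j, a <= t <= b -> `|j| <= K%:Z -> f t0 j0 <= f t j].
Proof.
move=> ab fc.
have /choice[c cP] : forall j, exists c, (a <= c <= b) /\
    forall t, a <= t <= b -> f c j <= f t j.
  move=> j; have [c cab cm] := EVT_min ab (fc j).
  exists c; split=> [|t tab]; first by rewrite in_itv in cab.
  by apply: cm; rewrite in_itv.
pose g (i : 'I_(K + K).+1) : int := i%:Z - K%:Z.
pose F (i : 'I_(K + K).+1) : R := f (c (g i)) (g i).
have [i _ im] := @arg_minP _ _ _ ord0 xpredT F isT.
exists (c (g i)), (g i); split; first by have [] := cP (g i).
  by have := ltn_ord i; rewrite /g; lia.
move=> t j tab jK.
have h : (absz (j + K%:Z)%R < (K + K).+1)%N by lia.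
have -> : j = g (Ordinal h) by rewrite /g /=; lia.
by apply: le_trans (im (Ordinal h) isT) _; have [_] := cP (g (Ordinal h)); exact.
Qed.

Lemma lap_parabola (R : realType) (e : R) (j : int) :
  lap (fun i : int => e * i%:~R ^+ 2) j = 2 * e.
Proof. by rewrite /lap intrD intrB; ring. Qed.

Lemma lapD (R : realType) (p q : int -> R) (j : int) :
  lap (fun i => p i + q i) j = lap p j + lap q j.
Proof. by rewrite /lap; ring. Qed.

Lemma within_continuousD (R : realType) (A : set R) (f g : R -> R) :
  {within A, continuous f} -> {within A, continuous g} ->
  {within A, continuous (fun t => f t + g t)}.
Proof. by move=> fc gc t; apply: cvgD; [exact: fc|exact: gc]. Qed.

Lemma within_continuous_ge0 (R : realType) (f : R -> R) (a b : R) :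
  a < b -> {within `[a, b], continuous f} ->
  (forall t, a < t < b -> 0 <= f t) -> 0 <= f b.
Proof.
move=> ab /subspace_continuousP fc f0.
have fb : f s @[s --> b^'-] --> f b.
  have /(_ b) := fc; rewrite /= in_itv /= lexx ltW // => /(_ isT) cb.
  apply: cvg_trans cb; apply: cvg_app.
  move=> A /= [e e0 Ae]; exists (Order.min e (b - a)).
    by rewrite /= lt_min e0 subr_gt0.
  move=> s /=; rewrite lt_min => /andP[se sa] sb; apply: Ae => //=.
  by rewrite in_itv /=; move: sa; rewrite gtr0_norm ?subr_gt0//; lra.
apply: (cvgr_to_ge fb); exists (b - a); first by rewrite /= subr_gt0.
by move=> s /= sa sb; apply: f0; move: sa; rewrite gtr0_norm ?subr_gt0//; lra.
Qed.

(* The penalization [e (1 + j^2 + 3 (t - a))] makes the supersolution strict and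
   confines its minimum to finitely many sites. *)
Lemma lattice_comparison (R : realType) (D : set int) (y : R -> int -> R)
    (a b M : R) :
  a < b -> (forall j, {within `[a, b], continuous (fun t => y t j)}) ->
  (forall j t, a < t < b -> D j ->
     exists2 d, is_derive t 1 (fun s => y s j) d & lap (y t) j <= d) ->
  (forall j, 0 <= y a j) ->
  (forall j t, a < t < b -> ~ D j -> 0 <= y t j) ->
  (forall j t, a <= t <= b -> - M <= y t j) ->
  forall j t, a <= t <= b -> 0 <= y t j.
Proof.
move=> ab yc ysup ya yD yM.
(* The end time [b] follows by continuity. For [t < b] every time in []a, t]] is interior to []a,
   b[], where the derivative is available. *)
suff ltb j t : a <= t < b -> 0 <= y t j.
  move=> j t /andP[at_ tb].
  move: tb; rewrite le_eqVlt => /orP[/eqP->|tb]; last by apply: ltb; rewrite at_.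
  apply: (within_continuous_ge0 _ (fun t => y t j) _ _ ab) => // s sab.
  by apply: ltb; lra.
move=> /andP[at_ tb]; rewrite leNgt; apply/negP => ytj.
pose q := 1 + (j%:~R : R) ^+ 2 + 3 * (t - a).
have q0 : 0 < q by rewrite /q; have := sqr_ge0 (j%:~R : R); lra.
(* With this [e] the penalization at [(t, j)] equals [- y t j / 2], so [w t j] remains negative. *)
pose e := - y t j / (2 * q).
have e0 : 0 < e by rewrite /e divr_gt0//; lra.
pose w s i := y s i + (e * i%:~R ^+ 2 + e * (1 + 3 * (s - a))).
have wtj : w t j < 0.
  have -> : w t j = y t j + e * q by rewrite /w /q; ring.
  have -> : e * q = - y t j / 2 by rewrite /e; field; rewrite lt0r_neq0.
  by lra.
have sub : `[a, t] `<=` `[a, b].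
  by move=> s /=; rewrite !in_itv /= => /andP[-> /le_trans]; apply; exact: ltW.
have wc i : {within `[a, t], continuous (fun s => w s i)}.
  apply: within_continuousD; first exact: (continuous_subspaceW sub (yc i)).
  apply: continuous_subspaceT => s.
  apply: cvgD; first exact: cvg_cst.
  apply: cvgM; first exact: cvg_cst.
  apply: cvgD; first exact: cvg_cst.
  apply: cvgM; first exact: cvg_cst.
  by apply: cvgD; [exact: cvg_id|exact: cvg_cst].
(* Beyond [K] one has [e * i^2 >= e * K > M], which outweighs the lower bound of [y]. The summand
   [absz j] keeps [j] inside the window. *)
pose K := (Num.bound `|M / e| + absz j)%N.
have wK s i : a <= s <= t -> `|i| > K%:Z -> 0 <= w s i.
  move=> sat iK.
  have := yM i s; have -> : a <= s <= b by lra.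
  move=> /(_ isT) yM'.
  have h : M / e < K%:R.
    apply: le_lt_trans (ler_norm _) _.
    apply: lt_le_trans (archi_boundP (normr_ge0 _)) _.
    by rewrite ler_nat leq_addr.
  rewrite ltr_pdivrMr // in h.
  have : (K%:R : R) <= i%:~R ^+ 2.
    have : K%:Z <= i ^+ 2 by clear -iK; nia.
    by rewrite -(ler_int R) rmorphXn.
  rewrite -(ler_pM2r e0) /w.
  have : 0 <= e * (1 + 3 * (s - a)) by rewrite mulr_ge0 //; lra.
  lra.
have [t0 [j0 [t0at j0K wm]]] := segment_uniform_min _ w a t K at_ wc.
have wm0 : w t0 j0 < 0.
  by apply: le_lt_trans (wm t j _ _) wtj; [rewrite at_ lexx | rewrite /K; lia].
have wmin s i : a <= s <= t -> w t0 j0 <= w s i.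
  move=> sat; have [iK|iK] := leP `|i| K%:Z; first exact: wm.
  by apply: le_trans (ltW wm0) _; exact: wK.
have pos s i : a <= s -> 0 <= e * i%:~R ^+ 2 + e * (1 + 3 * (s - a)).
  by move=> as_; rewrite addr_ge0 // mulr_ge0 ?sqr_ge0 //; lra.
have at0 : a < t0.
  rewrite lt_neqAle (andP t0at).1 andbT; apply/eqP => at0.
  have := ya j0; have := pos t0 j0; rewrite at0 lexx.
  by move: wm0; rewrite /w -at0; lra.
have t0b : a < t0 < b by lra.
have Dj0 : D j0.
  apply: contrapT => /(yD j0 t0); rewrite t0b.
  by move=> /(_ isT); have := pos t0 j0 (ltW at0); move: wm0; rewrite /w; lra.
have [d dy dlap] := ysup j0 t0 t0b Dj0.
have dw : is_derive t0 1 (fun s => w s j0) (d + 3 * e).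
  apply: is_deriveD; apply: is_derive_eq.
  rewrite !(add0r, scaler0, addr0, subr0, scaler1, mul0r, mulr0).
  by rewrite /GRing.scale /=; ring.
(* At the minimum [lap (w t0) j0 >= 0], and the parabola contributes [2 * e] to it, hence
   [d >= -2 * e]. This contradicts [d + 3 * e <= 0]. *)
have : d + 3 * e <= 0.
  by apply: (is_derive_left_min_le0 _ _ _ _ _ at0 dw) => s st0; apply: wmin; lra.
suff : - 2 * e <= lap (y t0) j0 by lra.
have : 0 <= lap (w t0) j0.
  rewrite /lap; have := wmin t0 (j0 + 1) t0at; have := wmin t0 (j0 - 1) t0at; lra.
rewrite /w !lapD lap_parabola /lap; lra.
Qed.

(** * Heat kernel on a discrete interval *)

Lemma sin_le_id (R : realType) (x : R) : 0 <= x -> sin x <= x.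
Proof.
rewrite le_eqVlt => /orP[/eqP<-|x0]; first by rewrite sin0.
have [|c _] := @MVT _ sin cos 0 x x0.
  by apply: continuous_subspaceT; exact: continuous_sin.
by rewrite sin0 !subr0 => ->; rewrite ler_piMl ?cos_le1// ltW.
Qed.

(** By the half-angle formula the left side is [2 * sin (x / 2) ^+ 2]. Then [sin y <= y] applies for
    [y <= pi], and [sin y ^+ 2 <= 1] suffices beyond. *)
Lemma one_minus_cos_le (R : realType) (x : R) : 0 <= x -> 1 - cos x <= x ^+ 2 / 2.
Proof.
move=> x0; have -> : x = (x / 2) *+ 2 by rewrite mulr2n; lra.
rewrite cos_mulr2n cos2sin2.
set y := x / 2; have y0 : 0 <= y by rewrite /y; lra.
have [ypi|ypi] := leP y pi; last first.
  have s1 : sin y ^+ 2 <= 1 by have := sin_le1 y; have := sin_geN1 y; nra.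
  have y2 : 4 <= y ^+ 2 by have := pi_ge2 R; nra.
  rewrite -[(1 - _) *+ 2]mulr_natl -[y *+ 2]mulr_natl; lra.
have := sin_le_id _ _ y0; have := @sin_ge0_pi _ y; rewrite y0 ypi => /(_ isT).
move=> s0 sy; have : sin y ^+ 2 <= y ^+ 2 by rewrite ler_sqr.
rewrite -[(1 - _) *+ 2]mulr_natl -[y *+ 2]mulr_natl; lra.
Qed.

Lemma sin_natpi (R : realType) (n : nat) : sin (pi * n%:R : R) = 0.
Proof.
elim: n => [|n IH]; first by rewrite mulr0 sin0.
by rewrite -natr1 mulrDr mulr1 sinDpi IH oppr0.
Qed.

Lemma cos_odd_pihalf (R : realType) (n : nat) :
  cos (n.*2.+1%:R * (pi / 2) : R) = 0.
Proof.
elim: n => [|n IH]; first by rewrite mul1r cos_pihalf.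
have -> : n.+1.*2.+1%:R * (pi / 2) = n.*2.+1%:R * (pi / 2) + pi :> R.
  by rewrite doubleS -[n.*2.+3]addn2 natrD; field.
by rewrite cosDpi IH oppr0.
Qed.

(** The sum telescopes: [2 sin x cos ((2n+1) x) = sin ((2n+2) x) - sin (2n x)]. *)
Lemma sum_cos_odd (R : realType) (N : nat) (x : R) :
  2 * sin x * (\sum_(n < N) cos (n.*2.+1%:R * x)) = sin (N.*2%:R * x).
Proof.
elim: N => [|N IH]; first by rewrite big_ord0 mulr0 mul0r sin0.
rewrite big_ord_recr /= mulrDr IH.
have -> : N.*2%:R * x = N.*2.+1%:R * x - x by rewrite -natr1; ring.
have -> : N.+1.*2%:R * x = N.*2.+1%:R * x + x by rewrite doubleS -natr1; ring.
by rewrite sinB sinD; ring.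
Qed.

(* The modes cos ((2n+1) pi i / 2N) are the symmetric eigenvectors of the lattice
   Laplacian vanishing at i = N and i = -N. *)
Definition dirichlet_kernel (R : realType) (N : nat) (s : R) (i : int) : R :=
  N%:R^-1 * \sum_(n < N)
    expR (- (2 - 2 * cos (n.*2.+1%:R * (pi / N.*2%:R))) * s) *
    cos (n.*2.+1%:R * (pi / N.*2%:R) * i%:~R).

Lemma cos_absz (R : realType) (x : R) (i : int) :
  cos (x * i%:~R) = cos (x * (absz i)%:R).
Proof. by case: i => [n //|n]; rewrite NegzE mulrNz mulrN cosN abszN. Qed.

(** Each mode is caloric because [cos (x (i+1)) + cos (x (i-1)) = 2 cos x cos (x i)], so its decay
    rate [2 - 2 cos x] is the negative of its Laplacian eigenvalue. *)
Lemma is_derive_dirichlet_kernel (R : realType) (N : nat) (s : R) (i : int) :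
  is_derive s 1 (fun s => dirichlet_kernel R N s i)
    (lap (dirichlet_kernel R N s) i).
Proof.
pose x (n : 'I_N) : R := n.*2.+1%:R * (pi / N.*2%:R).
pose mode (n : 'I_N) (s : R) (i : int) : R :=
  expR (- (2 - 2 * cos (x n)) * s) * cos (x n * i%:~R).
have dmode n : is_derive s 1 (fun s => mode n s i) (lap (mode n s) i).
  rewrite /mode; set l := - (2 - _).
  have dl : is_derive s 1 (fun s : R => l * s) l.
    by apply: is_derive_eq; rewrite /GRing.scale /= mulr1.
  have de := is_derive1_comp (is_derive_expR (l * s)) dl.
  apply: is_derive_eq.
  rewrite /lap intrD intrB !mulrDr mulr1 mulrN1 cosD cosB /GRing.scale /= /l.
  by ring.
have -> : lap (dirichlet_kernel R N s) i =
    N%:R^-1 * \sum_(n < N) lap (mode n s) i.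
  by rewrite /lap /dirichlet_kernel big_split /= sumrB -mulr_sumr; ring.
have -> : (fun s => dirichlet_kernel R N s i) =
    N%:R^-1 \*: (\sum_(n < N) (fun s => mode n s i)).
  by apply/funext => t /=; rewrite fct_sumE.
have ds := is_derive_sum dmode; exact: is_deriveZ.
Qed.

Lemma dirichlet_kernel0 (R : realType) (N : nat) (i : int) : `|i| < N%:Z ->
  dirichlet_kernel R N 0 i = (i == 0)%:R.
Proof.
move=> iN; have N0 : N%:R != 0 :> R by rewrite pnatr_eq0; lia.
have N20 : N.*2%:R != 0 :> R by rewrite pnatr_eq0; lia.
rewrite /dirichlet_kernel; under eq_bigr do rewrite mulr0 expR0 mul1r.
have [->|i0] := eqVneq i 0.
  under eq_bigr do rewrite mulr0 cos0.
  by rewrite sumr_const card_ord mulVf.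
set x := pi / N.*2%:R * (absz i)%:R : R.
under eq_bigr do rewrite cos_absz -mulrA -/x.
suff -> : \sum_(n < N) cos (n.*2.+1%:R * x) = 0 by rewrite mulr0.
(* Here [0 < x < pi], so the closed form of the cosine sum may be divided by [2 * sin x]; its
   numerator is the sine of an integer multiple of [pi]. *)
have sx : 2 * sin x != 0.
  rewrite mulf_neq0 // gt_eqF // sin_gt0_pi //; apply/andP; split.
    by rewrite mulr_gt0 ?divr_gt0 ?pi_gt0 ?ltr0n //; lia.
  rewrite /x mulrAC -mulrA gtr_pMr ?pi_gt0 // ltr_pdivrMr;
    by rewrite ?mul1r ?ltr_nat ?ltr0n; lia.
apply: (mulfI sx); rewrite sum_cos_odd mulr0 /x.
by rewrite mulrA mulrCA mulfV // mulr1 sin_natpi.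
Qed.

Lemma dirichlet_kernel_boundary (R : realType) (N : nat) (s : R) (i : int) :
  (0 < N)%N -> `|i| = N%:Z -> dirichlet_kernel R N s i = 0.
Proof.
move=> N0 iN; rewrite /dirichlet_kernel big1 ?mulr0 // => n _.
rewrite cos_absz; have -> : absz i = N by lia.
rewrite -mulrA; have -> : pi / N.*2%:R * N%:R = pi / 2 :> R.
  by rewrite -muln2 natrM; field; rewrite pnatr_eq0; lia.
by rewrite cos_odd_pihalf mulr0.
Qed.

Lemma dirichlet_kernel_le1 (R : realType) (N : nat) (s : R) (i : int) :
  0 <= s -> dirichlet_kernel R N s i <= 1.
Proof.
move=> s0; rewrite /dirichlet_kernel.
case: N => [|N]; first by rewrite invr0 mul0r.
rewrite mulrC ler_pdivrMr ?ltr0n // mul1r.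
have -> : N.+1%:R = \sum_(n < N.+1) 1 :> R by rewrite sumr_const card_ord.
apply: ler_sum => n _.
have e1 : expR (- (2 - 2 * cos (n.*2.+1%:R * (pi / N.+1.*2%:R))) * s) <= 1.
  by rewrite -[leRHS]expR0 ler_expR mulNr oppr_le0 mulr_ge0 //.
by apply: le_trans e1; rewrite ler_piMr ?expR_ge0 // cos_le1.
Qed.

(** All modes are positive at the centre, so the slowest one alone gives a lower bound. Its
    frequency [x] satisfies [x * N = pi / 2 <= 2], so up to time [N^2] its exponent is at least
    [-4]. *)
Lemma dirichlet_kernel_center_ge (R : realType) (N : nat) (s : R) :
  (0 < N)%N -> 0 <= s <= N%:R ^+ 2 ->
  expR (- 4) / N%:R <= dirichlet_kernel R N s 0.
Proof.
move=> N0 /andP[s0 sN].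
rewrite /dirichlet_kernel mulrC ler_pM2l ?invr_gt0 ?ltr0n//.
case: N N0 sN => // N _ sN.
rewrite big_ord_recl; under eq_bigr do rewrite mulr0 cos0 mulr1.
rewrite mulr0 cos0 mulr1 mul1r.
apply: le_trans (_ : _ <= expR (- (2 - 2 * cos (pi / N.+1.*2%:R)) * s)) _;
  last first.
  by rewrite lerDl sumr_ge0 // => i _; exact: expR_ge0.
rewrite ler_expR.
have N1 : 0 < N.+1%:R :> R by rewrite ltr0n.
set x := pi / N.+1.*2%:R : R.
have x0 : 0 <= x by rewrite /x divr_ge0 ?pi_ge0.
have xN : x * N.+1%:R <= 2.
  have -> : x * N.+1%:R = pi / 2.
    rewrite /x -muln2 natrM; field.
    by rewrite -natr1 addrC in N1; exact: lt0r_neq0.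
  exact/ltW/pihalf_lt2.
have cx := one_minus_cos_le _ _ x0.
have c1 := cos_le1 x.
have : (2 - 2 * cos x) * s <= x ^+ 2 * N.+1%:R ^+ 2.
  by apply: ler_pM => //; lra.
rewrite -exprMn; have : (x * N.+1%:R) ^+ 2 <= 2 ^+ 2.
  by rewrite ler_sqr ?nnegrE // mulr_ge0.
rewrite mulNr; lra.
Qed.

(** * Phases of a single-interface solution *)

Lemma Xset_gt0 (R : realType) (k j : int) (v : int -> R) :
  Xset k v -> j < k -> 0 < v j.
Proof.
move=> [_ /andP[L0 _] _ _ _] jk; rewrite -lte_fin; apply: lt_le_trans L0 _.
by apply: ereal_inf_lbound; exists j.
Qed.

Lemma Xset_lt0 (R : realType) (k j : int) (v : int -> R) :
  Xset k v -> k <= j -> v j < 0.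
Proof.
move=> [_ _ _ _ U0] jk; rewrite -lte_fin; apply: le_lt_trans U0.
by apply: ereal_sup_ubound; exists j.
Qed.

(* On [Xset k] this is 1 - Phi'(v); for fixed [k] it stays continuous in time
   at the end points of phase k. *)
Definition codistance (R : realType) (k : int) (v : int -> R) (j : int) : R :=
  (if j < k then 2 else 0) - v j.

Lemma dPhi_codistance (R : realType) (k : int) (v : int -> R) :
  Xset k v -> @dPhi R \o v = fun j => 1 - codistance R k v j.
Proof.
move=> Xv; apply/funext => j /=; rewrite /dPhi /sgnr /codistance.
have [jk|kj] := ltP j k.
  by rewrite ltNge (ltW (Xset_gt0 _ _ _ _ Xv jk)) /=; ring.
by rewrite (Xset_lt0 _ _ _ _ Xv kj); ring.
Qed.

(** The integrating factor [expR (2 * t)] turns the differential inequality into monotonicity of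
    [h]. *)
Lemma gt0_of_derive_ge_decay (R : realType) (f : R -> R) (a b : R) :
  a < b -> {within `[a, b], continuous f} ->
  (forall t, a < t < b -> 0 < f t) ->
  (forall t, a < t < b -> exists2 d, is_derive t 1 f d & - 2 * f t <= d) ->
  0 < f b.
Proof.
move=> ab fc f0 fd.
(* Positivity is known only inside the interval, so the monotonicity argument starts at the
   midpoint. *)
pose c := (a + b) / 2; have cb : c < b by rewrite /c; lra.
have ac : a < c by rewrite /c; lra.
pose h t := expR (2 * t) * f t.
have hd t : t \in `]c, b[ -> exists2 d, is_derive t 1 h d & 0 <= d.
  rewrite in_itv /= => tcb; have [|d df fd2] := fd t; first by lra.
  have dl : is_derive t 1 (fun s : R => 2 * s) 2.
    by apply: is_derive_eq; rewrite /GRing.scale /= mulr1.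
  have de := is_derive1_comp (is_derive_expR (2 * t)) dl.
  have dh : is_derive t 1 h (expR (2 * t) * d + f t * (expR (2 * t) * 2)).
    exact: (is_deriveM de df).
  exists (expR (2 * t) * d + f t * (expR (2 * t) * 2)) => //.
  have -> : expR (2 * t) * d + f t * (expR (2 * t) * 2) =
     expR (2 * t) * (d - - 2 * f t) by ring.
  by rewrite mulr_ge0 ?expR_ge0 // subr_ge0.
have hcb : h c <= h b.
  apply: (@ger0_derive1_le_cc _ h c b); rewrite ?in_itv /= ?lexx ?ltW //.
  - by move=> t /hd[d dh _]; exact: ex_derive.
  - by move=> t /hd[d dh d0]; rewrite derive1E derive_val.
  have hfc : {within `[c, b], continuous f}.
    apply: continuous_subspaceW fc => t /=; rewrite !in_itv /= => /andP[ct ->].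
    by rewrite andbT; lra.
  move=> t; apply: cvgM; last exact: hfc.
  apply: (@continuous_subspaceT _ _ _ (fun t : R => expR (2 * t))) => s.
  apply: continuous_comp; last exact: continuous_expR.
  by apply: cvgM; [exact: cvg_cst|exact: cvg_id].
have hc : 0 < h c by rewrite mulr_gt0 ?expR_gt0// f0// ac.
by have := lt_le_trans hc hcb; rewrite pmulr_rgt0 ?expR_gt0.
Qed.

Lemma within_uniform_near (R : realType) (A : set R) (u : R -> int -> R) (t e : R) :
  {within A, continuous (u : R -> {uniform int -> R})} -> A t -> 0 < e ->
  \forall s \near t, A s -> forall j, `|u t j - u s j| < e.
Proof.
move=> /subspace_continuousP uc At e0.
have : nbhs (u t : {uniform int -> R})
    [set h : int -> R | forall j, `|u t j - h j| < e].
  apply/uniform_nbhs; exists [set xy : R * R | `|xy.1 - xy.2| < e]; split.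
    by rewrite -entourage_ballE; exists e.
  by move=> h /= hj j; exact: hj.
by move=> /(uc t At); rewrite /= /within.
Qed.

Lemma sis_within_continuous (R : realType) (u : R -> int -> R) (T : nat -> \bar R)
    (a b : R) (j : int) :
  single_interface_solution u T -> 0 <= a ->
  {within `[a, b], continuous (fun t => u t j)}.
Proof.
move=> us a0; apply/subspace_continuousP => t; rewrite /= in_itv /= => /andP[at_ tb].
apply/cvgrPdist_lt => e e0; rewrite near_withinE.
have /(_ t e)  := within_uniform_near _ _ _ _ _ (sis_continuous us).
rewrite /= in_itv /= (le_trans a0 at_) => /(_ isT e0).
apply: filterS => s h; rewrite /= in_itv /= => /andP[as_ _].
by apply: h; rewrite in_itv /= (le_trans a0 as_).
Qed.

(** Each [u t] is bounded and nearby times are uniformly close, so compactness of the time segment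
    yields one bound. The comparison principle requires such a bound. *)
Lemma sis_bounded (R : realType) (u : R -> int -> R) (T : nat -> \bar R) (a b : R) :
  single_interface_solution u T -> 0 <= a ->
  exists M, forall t j, a <= t <= b -> `|u t j| <= M.
Proof.
move=> us a0.
have := (@compact_near_coveringP _ `[a, b]%classic).1 (@segment_compact _ a b).
move=> /(_ R +oo%R (fun M t => a <= t <= b -> forall j, `|u t j| <= M) _).
case.
  move=> t /=; rewrite in_itv /= => /andP[at_ tb].
  have [M [_ uM]] := sis_linfty us (le_trans a0 at_).
  have := within_uniform_near _ _ _ t 1 (sis_continuous us).
  rewrite /= in_itv /= (le_trans a0 at_) => /(_ isT ltr01) ut.
  exists ([set s | s \in `[0, +oo[ -> forall j, `|u t j - u s j| < 1],
          [set M' | M + 2 < M']).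
    by split; [exact: ut | exists (M + 2); split; [exact: num_real|]].
  move=> [s M'] /= [us1 MM'] /andP[as_ _] j.
  have := us1; rewrite in_itv /= (le_trans a0 as_) => /(_ isT j).
  have /= := uM (M + 1); rewrite ltrDl ltr01 => /(_ isT j I).
  have := ler_distD (u t j) (u s j) 0; rewrite !subr0 distrC; lra.
move=> M [_ h]; exists (M + 1) => t j tab.
by apply: (h (M + 1)); rewrite ?ltrDl //= in_itv.
Qed.

Lemma sis_T_ge0 (R : realType) (u : R -> int -> R) (T : nat -> \bar R) (k : nat) :
  single_interface_solution u T -> (0 <= T k)%E.
Proof.
move=> us; case: k => [|k]; first by rewrite (sis_T0 us).
by rewrite ltW // (sis_T_gt0 us).
Qed.

Lemma sis_codistance_derive (R : realType) (u : R -> int -> R) (T : nat -> \bar R)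
    (k : nat) (t : R) (j : int) :
  single_interface_solution u T -> (1 <= k)%N -> (T k.-1 < +oo)%E ->
  (T k.-1 < t%:E < T k)%E ->
  is_derive t 1 (fun s => codistance R k (u s) j) (lap (codistance R k (u t)) j).
Proof.
move=> us k1 Tk tk; have Xt := sis_phases us k1 Tk tk.
have t0 : 0 < t.
  by rewrite -lte_fin; apply: le_lt_trans (sis_T_ge0 _ _ _ k.-1 us) _; case/andP: tk.
(* At a transition time some site has value 0, whereas inside a phase every site is strictly
   positive or strictly negative. *)
have notT m : (1 <= m)%N -> T m <> t%:E.
  move=> m1 /(sis_transition us m1)[ut _].
  have [mk|km] := ltP m%:Z k%:Z.
    by have := Xset_gt0 _ _ _ _ Xt mk; rewrite ut ltxx.
  by have := Xset_lt0 _ _ _ _ Xt km; rewrite ut ltxx.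
have := sis_ode us j t0 notT; rewrite (dPhi_codistance _ _ _ Xt) => du.
rewrite /codistance; apply: is_derive_eq.
by rewrite /lap /codistance; ring.
Qed.

Lemma codistance_gt0 (R : realType) (k j : int) (v : int -> R) :
  Xset k v -> k <= j -> 0 < codistance R k v j.
Proof.
move=> Xv kj; rewrite /codistance (ltNge j) kj /=.
by have := Xset_lt0 _ _ _ _ Xv kj; lra.
Qed.

Lemma sis_codistance_continuous (R : realType) (u : R -> int -> R)
    (T : nat -> \bar R) (k : int) (a b : R) (j : int) :
  single_interface_solution u T -> 0 <= a ->
  {within `[a, b], continuous (fun t => codistance R k (u t) j)}.
Proof.
move=> us a0 t; rewrite /codistance; apply: cvgB; first exact: cvg_cst.
exact: (sis_within_continuous _ _ _ _ b j us a0).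
Qed.

(** Both neighbours of [j] have nonnegative codistance, so the equation gives [z' >= -2 z] at [j],
    and [z] stays positive up to the end of the phase. *)
Lemma sis_ahead_lt0 (R : realType) (u : R -> int -> R) (T : nat -> \bar R)
    (k : nat) (a b : R) (j : int) :
  single_interface_solution u T -> (1 <= k)%N -> T k.-1 = a%:E -> T k = b%:E ->
  a < b -> k%:Z <= j ->
  (forall t, a < t < b -> 0 <= codistance R k (u t) (j - 1)) -> u b j < 0.
Proof.
move=> us k1 Ta Tb ab kj zk.
have a0 : 0 <= a by rewrite -lee_fin -Ta (sis_T_ge0 _ u).
have tT t : a < t < b -> (T k.-1 < t%:E < T k)%E.
  by rewrite Ta Tb !lte_fin.
have Xt t : a < t < b -> Xset k%:Z (u t).
  by move=> /tT; apply: (sis_phases us k1); rewrite Ta ltry.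
have : 0 < codistance R k (u b) j.
  apply: (gt0_of_derive_ge_decay _ (fun t => codistance R k (u t) j) a b ab).
  - exact: (sis_codistance_continuous _ u T).
  - by move=> t /Xt Xt'; exact: codistance_gt0.
  move=> t tab; exists (lap (codistance R k (u t)) j).
    by apply: (sis_codistance_derive _ _ T) => //; [rewrite Ta ltry | exact: tT].
  have kj1 : k%:Z <= j + 1 by lia.
  have := zk t tab; have := codistance_gt0 _ _ _ _ (Xt t tab) kj1.
  by rewrite /lap; lra.
by rewrite /codistance (ltNge j) kj /=; lra.
Qed.

(** The monotonicity clause alone would allow a finite [T k] after an infinite time. But then [s]
    lies in an earlier phase or at its end, where site [k] is still negative and cannot vanish. *)
Lemma sis_T_pred_lty (R : realType) (u : R -> int -> R) (T : nat -> \bar R)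
    (k : nat) (s : R) :
  single_interface_solution u T -> (1 <= k)%N -> T k = s%:E -> (T k.-1 < +oo)%E.
Proof.
move=> us k1 Tk; rewrite ltey; apply/eqP => Tk1.
have [uk _] := sis_transition us k1 Tk.
have ex : exists l, (s%:E <= T l)%E by exists k.-1; rewrite Tk1 leey.
(* Minimality of [l] places [s] in phase [l], closed on the right: [T l.-1 < s <= T l]. *)
case: (ex_minnP ex) => l sl lmin.
have lk : (l <= k.-1)%N by apply: lmin; rewrite Tk1 leey.
have l1 : (1 <= l)%N.
  rewrite lt0n; apply/eqP => l0; move: sl; rewrite l0 (sis_T0 us).
  by rewrite leNgt -Tk (sis_T_gt0 us).
have Tl : (T l.-1 < s%:E)%E by rewrite ltNge; apply/negP => /lmin; lia.
have Tl1 : (T l.-1 < +oo)%E by rewrite (lt_trans Tl) ?ltry.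
suff : u s k < 0 by rewrite uk ltxx.
have lk' : l%:Z + 1 <= k%:Z by lia.
move: sl; rewrite le_eqVlt => /orP[/eqP sl|sl]; last first.
  by apply: (Xset_lt0 _ l%:Z); [apply: (sis_phases us) => //; rewrite Tl sl|lia].
have [a Ta] : exists a, T l.-1 = a%:E.
  exists (fine (T l.-1)); rewrite fineK // fin_numElt Tl1 andbT.
  by apply: lt_le_trans (sis_T_ge0 _ _ _ _ us); rewrite ltNyr.
have as_ : a < s by rewrite -lte_fin -Ta.
apply: (sis_ahead_lt0 _ _ T l a) => //; first by lia.
move=> t tas; apply/ltW/codistance_gt0; last by lia.
by apply: (sis_phases us l1 Tl1); rewrite Ta -sl !lte_fin.
Qed.

(** * Ramp bounds carried from phase to phase *)

Definition ramp (R : realType) (k j : int) : R :=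
  if j < k then (k - j)%:~R else 0.

Lemma ramp_ge0 (R : realType) (k j : int) : 0 <= ramp R k j.
Proof. by rewrite /ramp; case: ltP => // jk; rewrite ler0z; lia. Qed.

Lemma ramp_leS (R : realType) (k j : int) : ramp R k j <= ramp R (k + 1) j.
Proof.
rewrite /ramp; case: ltP => jk; case: ltP => jk' //; try lia.
- by rewrite ler_int; lia.
- by rewrite ler0z; lia.
Qed.

Lemma lap_ramp_behind (R : realType) (k j : int) :
  j < k -> lap (ramp R k) j = 0.
Proof.
(* The linear formula still holds at [i = k], which covers the right neighbour of site [k - 1]. *)
move=> jk; have rampE i : i <= k -> ramp R k i = (k - i)%:~R.
  move=> ik; rewrite /ramp; case: ltP => // ki.
  by have -> : k - i = 0 by lia.
rewrite /lap !rampE; try lia.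
by rewrite !(intrD, intrB, mulrNz); ring.
Qed.

(** Young's inequality, from [(x + N)^2 >= 0]. For natural [N] the right side is [caloric_parabola]
    at time 0, centred at [k]. *)
Lemma ramp_le_parabola (R : realType) (N : R) (k j : int) :
  0 < N -> ramp R k j <= (j - k)%:~R ^+ 2 / (2 * N) + N / 2.
Proof.
move=> N0; set x : R := (j - k)%:~R.
have : 0 <= (x + N) ^+ 2 by exact: sqr_ge0.
have x2 : 0 <= x ^+ 2 by exact: sqr_ge0.
have -> : x ^+ 2 / (2 * N) + N / 2 = (x ^+ 2 + N ^+ 2) / (2 * N).
  by field; rewrite gt_eqF.
rewrite /ramp; case: ltP => jk h; last first.
  by rewrite divr_ge0 ?addr_ge0 ?sqr_ge0// mulr_ge0 // ltW.
have -> : (k - j)%:~R = - x :> R by rewrite /x -mulrNz opprB.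
by rewrite ler_pdivlMr ?mulr_gt0 //; lra.
Qed.

Lemma sis_codistance_bounded (R : realType) (u : R -> int -> R)
    (T : nat -> \bar R) (k : int) (a b : R) :
  single_interface_solution u T -> 0 <= a ->
  exists M, forall t j, a <= t <= b -> - M <= codistance R k (u t) j.
Proof.
move=> us a0; have [M uM] := sis_bounded _ u T a b us a0.
exists M => t j /(uM t j); rewrite ler_norml /codistance.
by case: ifP => _ /andP[_ h]; lra.
Qed.

(** Comparison is applied behind the interface, where the ramp is caloric. From site [k] on, the
    sign condition of the phase gives nonnegativity. *)
Lemma sis_phase_ramp (R : realType) (u : R -> int -> R) (T : nat -> \bar R)
    (k : nat) (a b A : R) :
  single_interface_solution u T -> (1 <= k)%N -> T k.-1 = a%:E -> T k = b%:E ->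
  a < b -> 0 <= A ->
  (forall j, - A * ramp R k%:Z j <= codistance R k%:Z (u a) j) ->
  forall j t, a <= t <= b -> - A * ramp R k%:Z j <= codistance R k%:Z (u t) j.
Proof.
move=> us k1 Ta Tb ab A0 ua.
have a0 : 0 <= a by rewrite -lee_fin -Ta (sis_T_ge0 _ u).
have tT t : a < t < b -> (T k.-1 < t%:E < T k)%E by rewrite Ta Tb !lte_fin.
have Tk : (T k.-1 < +oo)%E by rewrite Ta ltry.
have [M uM] := sis_codistance_bounded _ u T k%:Z a b us a0.
suff h j t : a <= t <= b -> 0 <= codistance R k%:Z (u t) j + A * ramp R k%:Z j.
  by move=> j t /(h j); lra.
have Ar i : 0 <= A * ramp R k%:Z i by rewrite mulr_ge0 ?ramp_ge0.
apply: (lattice_comparison _ [set i | i < k%:Z]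
  (fun t j => codistance R k%:Z (u t) j + A * ramp R k%:Z j) a b M ab) => {j t}.
- move=> j; apply: within_continuousD; first exact: (sis_codistance_continuous _ u T).
  by move=> t; exact: cvg_cst.
- move=> j t tab jk; exists (lap (codistance R k%:Z (u t)) j).
    have := sis_codistance_derive _ u T k t j us k1 Tk (tT t tab) => dz.
    by apply: is_derive_eq; rewrite addr0.
  have -> : lap (fun i => codistance R k%:Z (u t) i + A * ramp R k%:Z i) j =
     lap (codistance R k%:Z (u t)) j + A * lap (ramp R k%:Z) j.
    by rewrite /lap; ring.
  by rewrite lap_ramp_behind // mulr0 addr0.
- by move=> j; have := ua j; lra.
- move=> j t tab /= /negP; rewrite -leNgt => kj.
  have Xt := sis_phases us k1 Tk (tT t tab).
  by rewrite addr_ge0 // ltW // codistance_gt0.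
- by move=> j t /(uM t j); have := Ar j; lra.
Qed.

Lemma codistanceS (R : realType) (k j : int) (v : int -> R) :
  codistance R (k + 1) v j = codistance R k v j + (if j == k then 2 else 0).
Proof.
rewrite /codistance; case: eqVneq => [->|jk]; first by rewrite ltzD1 lexx ltxx /=; ring.
by rewrite ltzD1 le_eqVlt (negbTE jk) addr0.
Qed.

Lemma sis_transition_time (R : realType) (u : R -> int -> R) (T : nat -> \bar R)
    (k : nat) (b : R) :
  single_interface_solution u T -> (1 <= k)%N -> T k = b%:E ->
  exists2 a, T k.-1 = a%:E & a < b.
Proof.
move=> us k1 Tb; have Tlt := sis_T_pred_lty _ u T k b us k1 Tb.
have Ta : T k.-1 = (fine (T k.-1))%:E.
  rewrite fineK // fin_numElt Tlt andbT.
  by apply: lt_le_trans (sis_T_ge0 _ _ _ _ us); rewrite ltNyr.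
exists (fine (T k.-1)) => //.
have [Too|] := sis_T_increasing us k1; first by rewrite Too ltxx in Tlt.
by rewrite Ta Tb lte_fin.
Qed.

(** Induction on phases with the same slope [A]: when the interface advances, the codistance does
    not decrease and the ramp grows, so the lower bound only weakens. *)
Lemma sis_ramp (R : realType) (u : R -> int -> R) (T : nat -> \bar R)
    (k : nat) (a A : R) :
  single_interface_solution u T -> 0 <= A ->
  (forall j, - A * ramp R 1 j <= codistance R 1 (u 0) j) ->
  (1 <= k)%N -> T k.-1 = a%:E ->
  forall j, - A * ramp R k%:Z j <= codistance R k%:Z (u a) j.
Proof.
move=> us A0 u0; elim: k a => // k IH a _.
case: k IH => [|k] IH /= Ta j.
  by move: Ta; rewrite (sis_T0 us) => -[<-]; exact: u0.
have [a' Ta' a'a] := sis_transition_time _ u T k.+1 a us (ltn0Sn _) Ta.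
have h := sis_phase_ramp _ _ _ _ _ _ _ us (ltn0Sn _) Ta' Ta a'a A0
  (IH a' (ltn0Sn _) Ta') j a.
move: h; rewrite (ltW a'a) lexx => /(_ isT).
have -> : k.+2%:Z = k.+1%:Z + 1 by lia.
rewrite codistanceS => h.
have : A * ramp R k.+1%:Z j <= A * ramp R (k.+1%:Z + 1) j.
  by rewrite ler_wpM2l ?ramp_leS.
by case: ifP => _; lra.
Qed.

(** Initial bound for the next phase: it keeps the ramp of phase [k], which vanishes at site [k],
    and records the jump by 2 there. *)
Lemma sis_ramp_transition (R : realType) (u : R -> int -> R) (T : nat -> \bar R)
    (k : nat) (b A : R) :
  single_interface_solution u T -> 0 <= A ->
  (forall j, - A * ramp R 1 j <= codistance R 1 (u 0) j) ->
  (1 <= k)%N -> T k = b%:E ->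
  forall j, (if j == k%:Z :> int then 2 else 0) - A * ramp R k%:Z j <=
    codistance R (k%:Z + 1) (u b) j.
Proof.
move=> us A0 u0 k1 Tb j; rewrite codistanceS.
have [a Ta ab] := sis_transition_time _ u T k b us k1 Tb.
have := sis_phase_ramp _ _ _ _ _ _ _ us k1 Ta Tb ab A0
  (sis_ramp _ _ _ _ _ _ us A0 u0 k1 Ta) j b.
by rewrite (ltW ab) lexx => /(_ isT); case: ifP => _; lra.
Qed.

(** * The interface site after a transition *)

Lemma is_derive_shift (R : realType) (f : R -> R) (a t d : R) :
  is_derive (t - a) 1 f d -> is_derive t 1 (fun s => f (s - a)) d.
Proof.
move=> df; have ds : is_derive t 1 (fun s : R => s - a) 1.
  by apply: is_derive_eq; rewrite oppr0 addr0.
by have := @is_derive1_comp _ f (fun s => s - a) t d 1 df ds; rewrite mulr1.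
Qed.

Lemma lap_shift (R : realType) (p : int -> R) (k j : int) :
  lap (fun i => p (i - k)) j = lap p (j - k).
Proof.
rewrite /lap; have -> : j + 1 - k = j - k + 1 by lia.
by have -> : j - 1 - k = j - k - 1 by lia.
Qed.

(* An exact caloric function dominating |i| at s = 0 and of size O(N) at i = 0
   for all s <= N^2. *)
Definition caloric_parabola (R : realType) (N : nat) (s : R) (i : int) : R :=
  (i%:~R ^+ 2 + 2 * s) / (2 * N%:R) + N%:R / 2.

Lemma is_derive_caloric_parabola (R : realType) (N : nat) (s : R) (i : int) :
  (0 < N)%N ->
  is_derive s 1 (fun s => caloric_parabola R N s i)
    (lap (caloric_parabola R N s) i).
Proof.
move=> N0; have N0' : N%:R != 0 :> R by rewrite pnatr_eq0; lia.
rewrite /caloric_parabola; apply: is_derive_eq.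
rewrite /lap intrD intrB /GRing.scale /=; field.
by rewrite N0'.
Qed.

(** Two comparisons: [y = z + V] is nonnegative everywhere, and then dominates twice the Dirichlet
    kernel on the window of radius [N] around [k]. Evaluation at the centre bounds [z] from
    below. *)
Lemma sis_interface_codistance_ge0 (R : realType) (u : R -> int -> R)
    (T : nat -> \bar R) (k N : nat) (a b A : R) :
  single_interface_solution u T -> T k = a%:E -> T k.+1 = b%:E ->
  a < b -> 0 <= A ->
  (forall j, (if j == k%:Z :> int then 2 else 0) - A * ramp R k%:Z j <=
    codistance R k.+1%:Z (u a) j) ->
  (0 < N)%N -> b - a <= N%:R ^+ 2 -> A * N%:R ^+ 2 <= 4 / 3 * expR (- 4) ->
  forall t, a < t < b -> 0 <= codistance R k.+1%:Z (u t) k%:Z.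
Proof.
move=> us Ta Tb ab A0 ua N0 baN AN.
have N0' : 0 < N%:R :> R by rewrite ltr0n.
have a0 : 0 <= a by rewrite -lee_fin -Ta (sis_T_ge0 _ u).
have tT t : a < t < b -> (T k.+1.-1 < t%:E < T k.+1)%E.
  by rewrite /= Ta Tb !lte_fin.
have Tk : (T k.+1.-1 < +oo)%E by rewrite /= Ta ltry.
have [M uM] := sis_codistance_bounded _ u T k.+1%:Z a b us a0.
pose V (t : R) (j : int) := A * caloric_parabola R N (t - a) (j - k%:Z).
pose y (t : R) (j : int) := codistance R k.+1%:Z (u t) j + V t j.
have V0 t j : a <= t -> 0 <= V t j.
  move=> at_; rewrite mulr_ge0 // /caloric_parabola.
  rewrite addr_ge0 ?divr_ge0 ?mulr_ge0 ?addr_ge0 ?sqr_ge0 //.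
  by rewrite mulr_ge0 // subr_ge0.
have dV (t : R) (j : int) : is_derive t 1 (fun s => V s j) (lap (V t) j).
  have dc := is_derive_shift _ (fun s => caloric_parabola R N s (j - k%:Z)) a t _
    (is_derive_caloric_parabola _ _ _ _ N0).
  rewrite /V; apply: is_derive_eq.
  by rewrite /GRing.scale /= -lap_shift /lap; ring.
have yc (j : int) : {within `[a, b], continuous (fun t => y t j)}.
  apply: within_continuousD; first exact: (sis_codistance_continuous _ u T).
  by apply: derivable_within_continuous => t _; have := dV t j => ?; exact: ex_derive.
have dy (t : R) (j : int) : a < t < b -> is_derive t 1 (fun s => y s j) (lap (y t) j).
  move=> tab; have dz := sis_codistance_derive _ u T k.+1 t j us (ltn0Sn _) Tk (tT t tab).
  have := dV t j => dVt.
  by rewrite /y; apply: is_derive_eq; rewrite -lapD.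
have ya j : (if j == k%:Z :> int then 2 else 0) <= y a j.
  rewrite /y /V; have := ua j.
  have := ramp_le_parabola R _ k%:Z j N0'.
  move=> /(ler_wpM2l A0); rewrite /caloric_parabola subrr mulr0 addr0.
  by case: ifP => _; lra.
have y0 : forall (j : int) t, a <= t <= b -> 0 <= y t j.
  apply: (lattice_comparison _ setT y a b M ab) => //.
  - by move=> j t tab _; exists (lap (y t) j) => //; exact: dy.
  - by move=> j; apply: le_trans (ya j); case: ifP.
  - by move=> j t _ [].
  - move=> j t tab; have := uM t j tab; have := V0 t j; rewrite /y.
    by move/andP: tab => [-> _] /(_ isT); lra.
(* The kernel vanishes at distance exactly [N], so extension by zero leaves the Laplacian at the
   sites of the window unchanged. *)
pose G (t : R) (j : int) := if `|j - k%:Z| < N%:Z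
  then 2 * dirichlet_kernel R N (t - a) (j - k%:Z) else 0.
have G2 t j : a <= t -> G t j <= 2.
  move=> at_; rewrite /G; case: ifP => // _.
  have := dirichlet_kernel_le1 R N (t - a) (j - k%:Z).
  by rewrite subr_ge0 => /(_ at_); lra.
have dG (t : R) (j : int) : `|j - k%:Z| < N%:Z ->
    is_derive t 1 (fun s => G s j) (lap (G t) j).
  move=> jN.
  have GE i : `|i - k%:Z| <= N%:Z ->
      G t i = 2 * dirichlet_kernel R N (t - a) (i - k%:Z).
    rewrite /G le_eqVlt => /orP[/eqP iN|->//].
    by rewrite iN ltxx dirichlet_kernel_boundary ?mulr0.
  have dD := is_derive_shift _ (fun s => dirichlet_kernel R N s (j - k%:Z)) a t _
    (is_derive_dirichlet_kernel R N (t - a) (j - k%:Z)).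
  have -> : (fun s => G s j) =
      fun s => 2 * dirichlet_kernel R N (s - a) (j - k%:Z).
    by apply/funext => s; rewrite /G jN.
  apply: is_derive_eq.
  rewrite /GRing.scale /= -lap_shift /lap !GE; try lia.
  by ring.
have Gc (j : int) : {within `[a, b], continuous (fun t => G t j)}.
  have [jN|jN] := ltP `|j - k%:Z| N%:Z.
    by apply: derivable_within_continuous => t _; have := dG t j jN => ?; exact: ex_derive.
  have -> : (fun t => G t j) = cst 0.
    by apply/funext => t; rewrite /G ltNge jN.
  by apply: continuous_subspaceT => t; exact: cvg_cst.
(* Outside the window [G] is zero and the first comparison supplies the sign; at time [a] both the
   jump at [k] and [G] equal [2] at site [k] and [0] elsewhere. *)
have yG : forall (j : int) t, a <= t <= b -> 0 <= y t j + - G t j.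
  apply: (lattice_comparison _ [set j | `|j - k%:Z| < N%:Z]
    (fun t j => y t j + - G t j) a b 2 ab).
  - move=> j; apply: within_continuousD; first exact: yc.
    by move=> t; apply: cvgN; exact: Gc.
  - move=> j t tab jN; exists (lap (y t) j - lap (G t) j).
      have dyt := dy t j tab; have dGt := dG t j jN.
      exact: is_deriveB.
    by rewrite /lap; lra.
  - move=> j; apply: le_trans (_ : y a j - (if j == k%:Z :> int then 2 else 0) <= _).
      by rewrite subr_ge0.
    rewrite lerD2l lerN2 /G; case: ifP => [jN|_]; last by case: ifP.
    rewrite subrr dirichlet_kernel0 // subr_eq0.
    by case: ifP; rewrite ?mulr1 ?mulr0.
  - move=> j t tab /= /negP/negbTE jN; rewrite /G jN subr0 y0 //; lra.
  - move=> j t tab; have := y0 j t tab; have := G2 t j.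
    by move/andP: tab => [-> _] /(_ isT); lra.
move=> t tab; have [at_ tb] := andP tab.
have := yG k%:Z t; rewrite (ltW at_) (ltW tb) => /(_ isT).
have kN : `|k%:Z - k%:Z| < N%:Z by rewrite subrr normr0; lia.
rewrite /y /G kN /V /caloric_parabola subrr.
have := dirichlet_kernel_center_ge R N (t - a) N0.
have -> : 0 <= t - a <= N%:R ^+ 2 by lra.
move=> /(_ isT).
(* Since [t - a <= N^2], the left side is at most [3/2 * A * N]; this explains the factor [4 / 3] in
   the bound on [A * N^2]. *)
suff : A * ((0%:~R ^+ 2 + 2 * (t - a)) / (2 * N%:R) + N%:R / 2) <=
  2 * (expR (- 4) / N%:R) by lra.
rewrite expr0n /= add0r mulrA ler_pdivlMr //.
have -> : A * (2 * (t - a) / (2 * N%:R) + N%:R / 2) * N%:R =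
  A * ((t - a) + N%:R ^+ 2 / 2) by field; rewrite gt_eqF.
apply: le_trans (_ : A * (N%:R ^+ 2 + N%:R ^+ 2 / 2) <= _); last by lra.
by rewrite ler_wpM2l // lerD2r; lra.
Qed.

(** * Initial data and the lower bound on waiting times *)

Lemma macroscopic_ramp (R : realType) (alpha beta eps A : R) (u0 : int -> R) :
  macroscopic_initial_data alpha beta eps u0 -> alpha * eps <= A ->
  forall j, - A * ramp R 1 j <= codistance R 1 u0 j.
Proof.
move=> [X0 _ grad _] aA j; rewrite (dPhi_codistance _ _ _ X0) in grad.
have step i : codistance R 1 u0 (i + 1) - A <= codistance R 1 u0 i.
  have : `|nablap (fun j => 1 - codistance R 1 u0 j) i| <= A.
    apply: le_trans aA; rewrite -lee_fin; apply: le_trans grad.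
    by apply: ereal_sup_ubound; exists i.
  by rewrite /nablap ler_norml => /andP[+ _]; lra.
rewrite /ramp; case: ltP => j1; last by rewrite mulr0 ltW // codistance_gt0.
have [n ->] : exists n : nat, j = 1 - n%:Z by exists (absz (1 - j)); lia.
have -> : 1 - (1 - n%:Z) = n%:Z by lia.
(* Induction on the distance from site 1, where the codistance is positive; each step to the left
   costs at most [A] by the gradient bound. *)
elim: n => [|n IH]; first by rewrite mulr0 subr0 ltW // codistance_gt0.
have := step (1 - n.+1%:Z); have -> : 1 - n.+1%:Z + 1 = 1 - n%:Z by lia.
have -> : n.+1%:Z%:~R = n%:Z%:~R + 1 :> R by rewrite -!pmulrn natr1.
by move: IH => /=; lra.
Qed.

Theorem lemma3p8 (R : realType) (alpha beta : R) :
  exists eps_star : R, 0 < eps_star < 1 /\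
  forall tau_fin : R, 0 < tau_fin ->
  exists d_star : R, 0 < d_star /\
  forall eps : R, 0 < eps -> eps <= eps_star ->
  forall (u : R -> int -> R) (T : nat -> \bar R),
    macroscopic_initial_data alpha beta eps (u 0) ->
    single_interface_solution u T ->
  forall k : nat, (1 <= k)%N ->
    (0%:E <= T k <= (tau_fin / eps ^+ 2)%:E)%E ->
    ((2 * d_star)%:E <= eps%:E * (T k.+1 - T k))%E.
Proof.
(* The slope will be [A = c * eps]; adding 1 makes [c] positive for every real [alpha]. *)
pose c := `|alpha| + 1 : R; have c1 : 1 <= c by rewrite lerDr.
have c0 : 0 < c by lra.
pose q := expR (- 4) : R; have q0 : 0 < q by exact: expR_gt0.
have q1 : q <= 1 by rewrite /q -[leRHS]expR0 ler_expR; lra.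
exists (q / (3 * c)); split.
  by rewrite divr_gt0 ?mulr_gt0 //= ltr_pdivrMr ?mulr_gt0 //; lra.
(* The choices give [4 * c * d = 2 * q / 3] and [2 * c * eps <= 2 * q / 3], which add up to the
   admissible [4 / 3 * q]. *)
move=> tau_fin _; pose d := q / (6 * c).
have d0 : 0 < d by rewrite divr_gt0 ?mulr_gt0.
exists d; split => // eps eps0 epsq u T u0 us k k1 /andP[Tk0 Tkt].
have [a Ta] : exists a, T k = a%:E.
  exists (fine (T k)); rewrite fineK // fin_numElt; apply/andP; split.
    by rewrite (lt_le_trans _ Tk0) ?ltNyr.
  by rewrite (le_lt_trans Tkt) ?ltry.
have := sis_T_ge0 _ u T k.+1 us.
case Tb : (T k.+1) => [b| |] // _; last first.
  by rewrite Ta /= mulr_infty /= gtr0_sg // mul1e leey.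
have [a' Ta' ab] := sis_transition_time _ u T k.+1 b us (ltn0Sn _) Tb.
move: Ta'; rewrite /= Ta => -[aa']; rewrite -{a'}aa' in ab.
rewrite -EFinB -EFinM lee_fin leNgt; apply/negP => short.
(* [S] bounds the length of the supposedly short phase, and [N] is the least natural number above
   its square root, so that [S <= N^2 <= 2 * S + 2]. *)
pose S := 2 * d / eps; have S0 : 0 <= S by apply/ltW/divr_gt0 => //; exact: mulr_gt0.
pose N := (Num.truncn (Num.sqrt S)).+1.
have /andP[Nl Nu] := truncn_itv (sqrtr_ge0 S).
have SS := sqr_sqrtr S0.
have SN : S <= N%:R ^+ 2 by rewrite -[leLHS]SS ler_sqr ?nnegrE ?sqrtr_ge0 // ltW.
have NS : N%:R ^+ 2 <= 2 * S + 2.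
  have : N%:R ^+ 2 <= (Num.sqrt S + 1) ^+ 2 :> R.
    by rewrite ler_sqr ?nnegrE ?addr_ge0 ?sqrtr_ge0 // -natr1 lerD2r.
  have : 0 <= (Num.sqrt S - 1) ^+ 2 by exact: sqr_ge0.
  by lra.
have A0 : 0 <= c * eps by rewrite mulr_ge0 // ltW.
have aA : alpha * eps <= c * eps.
  by rewrite ler_pM2r //; have := ler_norm alpha; rewrite /c; lra.
have ramp0 := macroscopic_ramp _ _ _ _ _ _ u0 aA.
have baN : b - a <= N%:R ^+ 2.
  apply: le_trans SN; rewrite /S ler_pdivlMr //; lra.
have AN : c * eps * N%:R ^+ 2 <= 4 / 3 * expR (- 4).
  apply: le_trans (_ : c * eps * (2 * S + 2) <= _); first by rewrite ler_wpM2l.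
  have -> : c * eps * (2 * S + 2) = 4 * (c * d) + 2 * (c * eps).
    by rewrite /S; field; rewrite gt_eqF.
  have -> : c * d = q / 6 by rewrite /d; field; rewrite gt_eqF.
  have : c * eps <= q / 3.
    by move: epsq; rewrite ler_pdivlMr ?mulr_gt0 // ler_pdivlMr //; lra.
  by rewrite -/q; lra.
have kS : k.+1%:Z = k%:Z + 1 by rewrite -addn1 PoszD.
have atk j :
    (if j == k%:Z :> int then 2 else 0) - c * eps * ramp R k%:Z j <=
    codistance R k.+1%:Z (u a) j.
  by rewrite kS; exact: (sis_ramp_transition _ u T).
have zk := sis_interface_codistance_ge0 _ _ _ _ _ _ _ _ us Ta Tb ab A0 atk
  (ltn0Sn _) baN AN.
(* Site [k + 1] is still negative at time [b], although the transition requires the value 0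
   there. *)
have : u b k.+1 < 0.
  apply: (sis_ahead_lt0 _ u T k.+1 a b) => // t tab.
  have -> : k.+1%:Z - 1 = k%:Z by rewrite kS addrK.
  exact: zk.
by have [-> _] := sis_transition us (ltn0Sn _) Tb; rewrite ltxx.
Qed.
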